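(* Let $M\ge 1$ and $p\ge 1$ be integers. For each $\alpha\in\{1,\dots,M\}$ let $\mathbb{M}_\alpha\in M_{N_\alpha}(\mathbf{C})$ be a Hermitian positive definite matrix, let $\mathbb{H}_\alpha\in M_{N_\alpha}(\mathbf{C})$ be a nonzero matrix that is self-adjoint with respect to the inner product $\langle u|v\rangle_\alpha:=u^*\mathbb{M}_\alpha v$, and let $\|\cdot\|_\alpha$ be the operator norm induced by this inner product. Let $\tau\in(0,1)$ be such that $h_\alpha:=\tau\|\mathbb{H}_\alpha\|_\alpha<1$ for every $\alpha$. Let $$\mathbb{H}_0:=\sum_{\alpha=1}^M \mathbf{1}_{1}\otimes\cdots\otimes\mathbf{1}_{\alpha-1}\otimes\mathbb{H}_\alpha\otimes\mathbf{1}_{\alpha+1}\otimes\cdots\otimes\mathbf{1}_{M},\qquad \hat{\mathbb{U}}:=\bigotimes_{\alpha=1}^M\hat{\mathbb{U}}_\alpha,\qquad \hat{\mathbb{U}}_\alpha:=R_{pp}(-i\tau\mathbb{H}_\alpha),$$ where $R_{pp}$ is the diagonal Padé approximant of the exponential. Then there exists $h\in(0,1)$ such that for every positive integer $m$ $$\left\|e^{-im\tau\mathbb{H}_0}-\hat{\mathbb{U}}^m\right\|\le\frac{(2^M-1)\,m^{2p+1}}{(2p+1)!}\,h^{2p+1},$$ where $\|\cdot\|$ is the operator norm on $\bigotimes_{\alpha}\mathbf{C}^{N_\alpha}$ induced by the inner product with matrix $\bigotimes_{\alpha}\mathbb{M}_\alpha$.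
   Context: $A^*$ denotes the conjugate transpose of a matrix $A$. A matrix $\mathbb{A}\in M_N(\mathbf{C})$ is self-adjoint with respect to the inner product $\langle u|v\rangle=u^*\mathbb{M}v$ ($\mathbb{M}$ Hermitian positive definite) if $\mathbb{A}^\dagger=\mathbb{A}$, where $\mathbb{A}^\dagger:=\mathbb{M}^{-1}\mathbb{A}^*\mathbb{M}$. The induced vector norm is $\|u\|=\langle u|u\rangle^{1/2}$ and the induced operator norm is $\|\mathbb{A}\|=\sup_{\|u\|=1}\|\mathbb{A}u\|$. $\mathbf{1}_\alpha$ is the identity matrix of size $N_\alpha$, and $\otimes$ is the Kronecker (tensor) product; in particular $e^{-it\mathbb{H}_0}=\bigotimes_\alpha e^{-it\mathbb{H}_\alpha}$. The diagonal Padé approximant of the exponential is $R_{pp}(Z):=D_{pp}(Z)^{-1}N_{pp}(Z)$ for a square matrix $Z$ (with $D_{pp}(Z)$ invertible), where $$N_{pp}(Z):=\sum_{j=0}^p\frac{(2p-j)!\,p!}{(2p)!\,j!\,(p-j)!}Z^j,\qquad D_{pp}(Z):=\sum_{j=0}^p\frac{(2p-j)!\,p!}{(2p)!\,j!\,(p-j)!}(-Z)^j.$$ *)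

(* Defs.v *)
From mathcomp Require Import all_boot all_order all_algebra.
From mathcomp Require Import all_classical all_reals all_analysis.
From mathcomp.real_closed Require Import complex.
From mathcomp.real_closed Require mxtens.

Set Implicit Arguments.
Unset Strict Implicit.
Unset Printing Implicit Defensive.

Import Order.TTheory GRing.Theory Num.Theory.
Import numFieldNormedType.Exports.

Local Open Scope classical_set_scope.
Local Open Scope ring_scope.
Local Open Scope complex_scope.
Local Open Scope sesquilinear_scope.

(* The limit is taken for the norm topology of the normed module ['M[K]_n]. *)
Definition expmx (K : numFieldType) (n : nat) (A : 'M[K]_n) : 'M[K]_n :=
  limn (series (fun k : nat => (k`!%:R : K)^-1 *: A ^+ k)).

Section Pade.
Variables (K : fieldType) (n : nat) (p : nat).
Implicit Type Z : 'M[K]_n.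

Definition pade_coef (j : nat) : K :=
  ((2 * p - j)`! * p`!)%:R / ((2 * p)`! * j`! * (p - j)`!)%:R.

Definition pade_num Z : 'M[K]_n := \sum_(j < p.+1) pade_coef j *: Z ^+ j.

Definition pade_den Z : 'M[K]_n := \sum_(j < p.+1) pade_coef j *: (- Z) ^+ j.

(* [invmx] is the inverse only when [pade_den Z] is invertible, as it is for
   [Z] with purely imaginary spectrum. *)
Definition pade Z : 'M[K]_n := invmx (pade_den Z) *m pade_num Z.
End Pade.

(* [bigtens A] is [A_0 *t (A_1 *t ( .. *t (A_(M-1) *t 1)))]; the trailing 1 is
   the 1 x 1 identity. *)
Fixpoint tensdim (M : nat) : ('I_M -> nat) -> nat :=
  match M with
  | 0 => fun _ => 1
  | M'.+1 => fun N => (N ord0 * tensdim (fun a => N (lift ord0 a)))%N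
  end.

Fixpoint bigtens (K : pzRingType) (M : nat) :
    forall N : 'I_M -> nat, (forall a, 'M[K]_(N a)) -> 'M[K]_(tensdim N) :=
  match M with
  | 0 => fun _ _ => 1%:M
  | M'.+1 => fun N A =>
      mxtens.tensmx (A ord0)
        (bigtens (N := fun a => N (lift ord0 a)) (fun a => A (lift ord0 a)))
  end.

Definition tenssum (K : pzRingType) (M : nat) (N : 'I_M -> nat)
    (A : forall a, 'M[K]_(N a)) : 'M[K]_(tensdim N) :=
  \sum_(a < M) bigtens (fun b => if b == a then A b else 1%:M).

Section InnerProduct.
Variables (R : realType) (n : nat).
Implicit Types (G A : 'M[R[i]]_n) (u v : 'cV[R[i]]_n).

Definition inner G u v : R[i] := (u ^t* *m G *m v) ord0 ord0.

Definition hermposdefmx G : Prop :=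
  G \is hermsymmx /\ forall u, u != 0 -> 0 < inner G u u.

Definition adjmx G A : 'M[R[i]]_n := invmx G *m A ^t* *m G.

Definition selfadjoint G A : Prop := adjmx G A = A.

(* [inner G u u] is a nonnegative real, hence equal to its real part, when [G]
   is Hermitian positive definite. *)
Definition vnorm G u : R := Num.sqrt (complex.Re (inner G u u)).

Definition opnorm G A : R :=
  sup [set vnorm G (A *m u) | u in [set u | vnorm G u = 1]].
End InnerProduct.

(* Main.v *)
Require Import Defs.
From mathcomp Require Import all_boot all_order all_algebra.
From mathcomp Require Import all_classical all_reals all_analysis.
From mathcomp Require Import ring zify.
From mathcomp.real_closed Require Import complex.
From mathcomp.real_closed Require mxtens.

(** The estimate is a scalar one, seen through a simultaneous diagonalization.

    A positive definite [G a] is a Gram matrix [S^* S], and [S H_a S^-1] is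
    Hermitian when [H a] is self-adjoint for [G a]; the spectral theorem then
    gives an invertible [T a] with [G a = (T a)^* (T a)] and
    [T a *m H a = diag (lam a) *m T a], the [lam a] being real
    ([selfadjoint_diagonalizable]).  Tensoring, [bigtens T] plays the same role
    for [bigtens G], and it diagonalizes every operator of the statement: the
    entries of a tensor product of diagonal matrices are the products of the
    entries over a multi-index ([diagby_bigtens]), and exponential, Pade
    approximant, sums and powers act on eigenvalues.  Since the norm defined by
    a Gram matrix [T^* T] is the Euclidean norm of [T u], the norm of an
    operator diagonalized by [T] is governed by its eigenvalues
    ([opnorm_diagby_le], [eigenvalue_le_opnorm]).

    It remains to compare, at each multi-index, the numbers
    [prod_a e^(i x_a)] and [prod_a r(i x_a)] raised to the power [m], with
    [x_a = - tau lam_a] and [r] the scalar Pade approximant, where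
    [|x_a| <= tau ||H_a|| < 1].  All factors have modulus 1, the denominator of
    [r] being the complex conjugate of its numerator on the imaginary axis, so
    the difference of the products is at most [m] times the sum over [a] of
    [|e^(i x_a) - r(i x_a)|] ([norm_prod_sub_le]).  With
    [|e^(ix) - r(ix)| <= |x|^(2p+1) / (2p+1)!] ([cpade_error]) this gives
    [m M h^(2p+1) / (2p+1)!] where [h] is the largest of the
    [tau ||H_a||] (and of [1/2], to make it positive), which is within the
    claimed bound because [M <= 2^M - 1] and [m <= m^(2p+1)].

    The scalar bound comes from the power series of [D(z) e^z], whose [k]-th
    coefficient is a [p]-th finite difference of a quotient of factorials and
    has the closed form [taylor_defect]: it equals the coefficient of the
    numerator for [k <= p], vanishes for [p < k <= 2p], and from [2p+1] on its
    modulus is at least halved at each step.  The remainder is thus at most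
    twice its first term, and the factor lost is recovered from
    [|D| >= 1/2 + 2^-p] and [(p!)^2 / (2p)! <= 2^-p]. *)

Set Implicit Arguments.
Unset Strict Implicit.
Unset Printing Implicit Defensive.

Import Order.TTheory GRing.Theory Num.Theory.
Import numFieldNormedType.Exports.

Local Open Scope classical_set_scope.
Local Open Scope ring_scope.
Local Open Scope complex_scope.
Local Open Scope sesquilinear_scope.

(** * Power series of the defect of the Pade approximant *)

Section PadeScalar.
Variable K : numFieldType.
Implicit Types (z : K) (p k j n : nat).

(** [D_pp(z)] is [pade_poly p (- z)]. *)
Definition pade_poly p z : K := \sum_(j < p.+1) pade_coef K p j * z ^+ j.

(** The inverse of [(k - j)!], read as 0 when [k - j] is negative: the coefficient
    of [z^k] in [z^j e^z].  This convention makes [inv_fact_subS] hold for all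
    [k] and [j], so that the three ranges of [k] are treated at once. *)
Definition inv_fact_sub k j : K := if (j <= k)%N then (k - j)`!%:R^-1 else 0.

Lemma fact_neq0 n : n`!%:R != 0 :> K.
Proof. by rewrite pnatr_eq0 -lt0n fact_gt0. Qed.

Lemma inv_fact_subS k j : inv_fact_sub k j.+1 = (k%:R - j%:R) * inv_fact_sub k j.
Proof.
rewrite /inv_fact_sub; case: (ltngtP j k) => [jk|//|->]; last by rewrite subrr mul0r.
  rewrite -natrB ?(ltnW jk) // (_ : k - j = (k - j.+1).+1)%N; last by lia.
  rewrite factS natrM invfM mulVKf // pnatr_eq0; lia.
by rewrite mulr0.
Qed.

(** The [p]-th iterate of the difference [f r - f r.+1]. *)
Definition altdiff p (f : nat -> K) (r : nat) : K :=
  \sum_(j < p.+1) (-1) ^+ j * 'C(p, j)%:R * f (r + j)%N.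

Lemma altdiffS p f r : altdiff p.+1 f r = altdiff p f r - altdiff p f r.+1.
Proof.
rewrite /altdiff big_ord_recl /= expr0 bin0 !mul1r addn0.
under eq_bigr => i _ do rewrite /bump /= add1n binS natrD mulrDr mulrDl.
rewrite big_split /= addrA; congr (_ + _).
  rewrite [in RHS]big_ord_recl /= expr0 bin0 !mul1r addn0; congr (_ + _).
  by rewrite big_ord_recr /= bin_small // mulr0 mul0r addr0.
rewrite -sumrN; apply: eq_bigr => i _.
by rewrite exprS mulN1r !mulNr addSnnS.
Qed.

(** One difference maps the quotient [(a-j)!/(k-j)!] to [a - k] times the same
    quotient with [a] lowered by one, whence the product after [p] steps. *)
Lemma altdiff_factratio a k p r : (p + r <= a)%N ->
  altdiff p (fun j => (a - j)`!%:R * inv_fact_sub k j) r =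
  \prod_(i < p) (a%:R - k%:R - i%:R) * (a - p - r)`!%:R * inv_fact_sub k r.
Proof.
elim: p r => [|p IHp] r le_pr_a.
  by rewrite /altdiff big_ord1 big_ord0 expr0 bin0 !mul1r addn0 subn0.
rewrite altdiffS !IHp; try lia.
rewrite big_ord_recr /= inv_fact_subS.
rewrite (_ : a - p - r = (a - p.+1 - r).+1)%N; last lia.
rewrite (_ : a - p - r.+1 = a - p.+1 - r)%N; last lia.
have -> : (a%:R : K) = (a - p.+1 - r)%:R + p%:R + 1 + r%:R.
  by rewrite -natrD -[1]/(1%:R) -!natrD; congr _%:R; lia.
rewrite factS natrM -natr1; ring.
Qed.

Lemma pade_coefE p j : (j <= p)%N ->
  pade_coef K p j = 'C(p, j)%:R * (2 * p - j)`!%:R / (2 * p)`!%:R.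
Proof.
move=> jp; rewrite /pade_coef -(bin_fact jp) !natrM.
field; by rewrite !fact_neq0.
Qed.

(** The closed form of the [k]-th Taylor coefficient of [D_pp(z) e^z]. *)
Definition taylor_defect p k : K :=
  \prod_(i < p) ((2 * p)%:R - k%:R - i%:R) * p`!%:R / k`!%:R / (2 * p)`!%:R.

Lemma sum_pade_coef_inv_fact_sub p k :
  \sum_(j < p.+1) pade_coef K p j * (-1) ^+ j * inv_fact_sub k j = taylor_defect p k.
Proof.
have := @altdiff_factratio (2 * p) k p 0.
rewrite addn0 subn0 (_ : 2 * p - p = p)%N; last by lia.
rewrite /inv_fact_sub /= subn0 => /(_ ltac:(lia)).
move=> /(congr1 (fun x => x / (2 * p)`!%:R)) /=; move=> H; rewrite /taylor_defect -H.
rewrite mulr_suml; apply: eq_bigr => j _; rewrite pade_coefE ?leq_ord //.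
rewrite /inv_fact_sub.
rewrite add0n; ring.
Qed.

Lemma taylor_defect_small p k : (k <= p)%N -> taylor_defect p k = pade_coef K p k.
Proof.
move=> kp; rewrite /taylor_defect /pade_coef.
have -> : \prod_(i < p) ((2 * p)%:R - k%:R - i%:R : K) = ((2 * p - k) ^_ p)%:R.
  rewrite ffact_prod natr_prod; apply: eq_bigr => i _.
  have ip := ltn_ord i; rewrite -!natrB //; lia.
rewrite -(@ffact_fact (2 * p - k) p); last by lia.
rewrite (_ : 2 * p - k - p = p - k)%N; last by lia.
rewrite !natrM; field; by rewrite !fact_neq0.
Qed.

(** One factor of the product vanishes: this is the order [2p] of the
    approximation. *)
Lemma taylor_defect_mid p k : (p < k <= 2 * p)%N -> taylor_defect p k = 0.
Proof.
move=> /andP[pk kp]; rewrite /taylor_defect.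
have ip : (2 * p - k < p)%N by lia.
rewrite (bigD1 (Ordinal ip)) //= natrB // subrr !mul0r //.
Qed.

(** The part of the coefficient of [z^(2p+1+n)] that depends on [n]. *)
Definition tail_weight p n : K :=
  (n + p)`!%:R / n`!%:R / (2 * p + 1 + n)`!%:R.

Lemma norm_taylor_defect_tail p n :
  `|taylor_defect p (2 * p + 1 + n)| = p`!%:R / (2 * p)`!%:R * tail_weight p n.
Proof.
rewrite /taylor_defect !normrM !normfV !normr_nat /tail_weight normr_prod.
have -> : \prod_(i < p) `|(2 * p)%:R - (2 * p + 1 + n)%:R - i%:R : K|
   = (n + p)`!%:R / n`!%:R.
  apply: canRL (mulfK (fact_neq0 n)) _.
  rewrite -(@ffact_fact (n + p) p) ?leq_addl // addnK [in RHS]natrM; congr (_ * _).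
  rewrite ffact_prod natr_prod (reindex_inj rev_ord_inj) /=.
  apply: eq_bigr => i _; have ip := ltn_ord i.
  rewrite distrC opprB addrCA -[RHS]normr_nat.
  congr `|_|; rewrite (_ : n + p - i = n + 1 + (p - i.+1))%N; last by lia.
  rewrite !natrD; ring.
by field; rewrite !fact_neq0.
Qed.

Lemma tail_weight_ge0 p n : 0 <= tail_weight p n.
Proof. by rewrite !mulr_ge0 ?invr_ge0. Qed.

(** The ratio is [(n+p+1) / ((n+1) (2p+n+2))]: exactly [1/2] for [n = 0], while for
    [n >= 1] already [1 / (n+1) <= 1/2] and the other factor is below 1. *)
Lemma tail_weight_halved p n : tail_weight p n.+1 <= tail_weight p n / 2.
Proof.
have -> : tail_weight p n.+1 =
    tail_weight p n * ((n + p).+1%:R / (n.+1 * (2 * p + 1 + n).+1)%:R).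
  rewrite /tail_weight addnS addSn !factS !natrM.
  by field; rewrite !fact_neq0 -[1]/(1%:R) -natrM -!natrD !pnatr_eq0.
rewrite ler_wpM2l ?tail_weight_ge0 // ler_pdivrMr ?ltr0n //.
rewrite mulrC ler_pdivlMr ?ltr0n // -natrM ler_nat; nia.
Qed.

Lemma sum_halving_le (u : nat -> K) n :
  (forall i, 0 <= u i) -> (forall i, u i.+1 <= u i / 2) ->
  \sum_(i < n) u i <= 2 * u 0%N.
Proof.
move=> u_ge0 u_half.
(* Adding [2 * u n], a bound on what is left, makes the induction go through. *)
suff: \sum_(i < n) u i + 2 * u n <= 2 * u 0%N.
  by apply: le_trans; rewrite lerDl mulr_ge0.
elim: n => [|n IHn]; first by rewrite big_ord0 add0r.
apply: le_trans IHn; rewrite big_ord_recr /= -addrA lerD2l.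
have := u_half n; rewrite ler_pdivlMr // => h.
by rewrite [leRHS]mulrDl !mul1r lerD2l mulrC.
Qed.

Lemma monomial_mul_exp_series z j n :
  z ^+ j * (\sum_(k < n) z ^+ k / k`!%:R) =
  \sum_(k < n + j) inv_fact_sub k j * z ^+ k.
Proof.
rewrite -(big_mkord xpredT (fun k => inv_fact_sub k j * z ^+ k)).
rewrite (big_cat_nat _ (leq_addl n j)) //=.
rewrite [X in _ = X + _]big_nat [X in _ = X + _]big1 ?add0r; last first.
  by move=> i /andP[_ ij]; rewrite /inv_fact_sub leqNgt ij mul0r.
rewrite -{2}[j]add0n big_addn addnK big_mkord mulr_sumr.
apply: eq_bigr => i _; rewrite /inv_fact_sub leq_addl addnK exprD; ring.
Qed.

(** The exponential series is cut at a different length in each term, so that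
    multiplying by [z^j] produces the same range of exponents for all [j]: the
    truncated product has no boundary terms. *)
Lemma pade_defectE p z n :
  \sum_(j < p.+1) pade_coef K p j * (- z) ^+ j *
     (\sum_(k < n + (p - j)) z ^+ k / k`!%:R)
  = \sum_(k < n + p) taylor_defect p k * z ^+ k.
Proof.
under [RHS]eq_bigr => k _ do rewrite -sum_pade_coef_inv_fact_sub mulr_suml.
rewrite exchange_big /=; apply: eq_bigr => j _.
rewrite (exprNn z) mulrA -[LHS]mulrA monomial_mul_exp_series.
rewrite -addnA subnK ?leq_ord //.
by rewrite mulr_sumr; apply: eq_bigr => k _; rewrite !mulrA.
Qed.

Lemma pade_defect_bound p z n : `|z| <= 1 ->
  `|\sum_(k < n + (2 * p + 1)) taylor_defect p k * z ^+ k - pade_poly p z|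
   <= 2 * p`!%:R ^+ 2 / (2 * p)`!%:R / (2 * p + 1)`!%:R * `|z| ^+ (2 * p + 1).
Proof.
move=> z1.
have -> : \sum_(k < n + (2 * p + 1)) taylor_defect p k * z ^+ k - pade_poly p z
   = \sum_(k < n) taylor_defect p (2 * p + 1 + k) * z ^+ (2 * p + 1 + k).
  rewrite addnC big_split_ord /= (_ : (2 * p + 1 = p.+1 + p)%N); last by lia.
  rewrite big_split_ord /= (_ : \sum_(i < p.+1) _ = pade_poly p z); last first.
    by apply: eq_bigr => i _; rewrite taylor_defect_small ?leq_ord.
  rewrite [X in _ + X + _ - _]big1 => [|i _]; last first.
    by rewrite taylor_defect_mid ?mul0r //; have := ltn_ord i; lia.
  by rewrite addr0 addrAC subrr add0r.
apply: le_trans (ler_norm_sum _ _ _) _.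
have -> : 2 * p`!%:R ^+ 2 / (2 * p)`!%:R / (2 * p + 1)`!%:R * `|z| ^+ (2 * p + 1)
   = p`!%:R / (2 * p)`!%:R * `|z| ^+ (2 * p + 1) * (2 * tail_weight p 0).
  rewrite /tail_weight addn0 add0n fact0; field; by rewrite !fact_neq0.
apply: (@le_trans _ _ (\sum_(k < n)
    p`!%:R / (2 * p)`!%:R * `|z| ^+ (2 * p + 1) * tail_weight p k)); last first.
  rewrite -mulr_sumr ler_wpM2l ?mulr_ge0 ?invr_ge0 ?exprn_ge0 //.
  by apply: sum_halving_le => i; [exact: tail_weight_ge0|exact: tail_weight_halved].
apply: ler_sum => k _; rewrite normrM norm_taylor_defect_tail normrX exprD.
rewrite mulrAC ler_wpM2r ?tail_weight_ge0 // ler_wpM2l ?mulr_ge0 ?invr_ge0 //.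
by rewrite ler_piMr ?exprn_ge0 // exprn_ile1.
Qed.

Lemma expn2_ffact_le p j : (2 ^ j * p ^_ j <= (2 * p) ^_ j)%N.
Proof.
elim: j => [|j IHj] //; rewrite expnS !ffactnSr.
rewrite (_ : (2 * 2 ^ j * _ = (2 ^ j * p ^_ j) * (2 * (p - j)))%N); last by lia.
by apply: leq_mul => //; lia.
Qed.

Lemma pade_coef_ge0 p j : 0 <= pade_coef K p j.
Proof. by rewrite /pade_coef mulr_ge0 ?invr_ge0. Qed.

(** The coefficient is [p^_j / (j! (2p)^_j)], and each factor [p - i] is at most
    half of [2p - i]. *)
Lemma pade_coef_le p j : (j <= p)%N -> pade_coef K p j <= 2 ^- j.
Proof.
move=> jp; rewrite pade_coefE // ler_pdivrMr ?ltr0n ?fact_gt0 //.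
rewrite ler_pdivlMl ?exprn_gt0 // -natrX -!natrM ler_nat.
rewrite -(@ffact_fact (2 * p) j); last by lia.
have := expn2_ffact_le p j; rewrite -bin_ffact => h.
rewrite mulnA leq_mul2r (leq_trans _ h) ?orbT // leq_mul2l.
by rewrite leq_pmulr ?fact_gt0 ?orbT.
Qed.

Lemma fact_sqr_le p : 2 ^+ p * p`!%:R ^+ 2 / (2 * p)`!%:R <= 1 :> K.
Proof.
rewrite ler_pdivrMr ?ltr0n ?fact_gt0 // mul1r -!natrX -natrM ler_nat.
have := expn2_ffact_le p p; rewrite ffactnn -(@ffact_fact (2 * p) p); last by lia.
rewrite (_ : 2 * p - p = p)%N; last by lia.
have := fact_gt0 p; nia.
Qed.
End PadeScalar.

(** * The exponential and its Pade approximant on the imaginary axis *)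

Lemma cvg_sum (K : numFieldType) (I : Type) (r : seq I) (u : I -> nat -> K)
    (l : I -> K) : (forall i, u i @ \oo --> l i) ->
  (fun n => \sum_(i <- r) u i n) @ \oo --> \sum_(i <- r) l i.
Proof.
move=> ul; elim: r => [|i r IHr].
  by rewrite big_nil; under eq_fun do rewrite big_nil; exact: cvg_cst.
by rewrite big_cons; under eq_fun do rewrite big_cons; exact: cvgD.
Qed.

(** Stated with an ordered field whose order need not be total, so that it applies
    to complex numbers. *)
Lemma norm_limit_le (K : numFieldType) (u : nat -> K) (l b B : K) (N : nat) :
  u @ \oo --> l -> (forall n, `|u (n + N)%N - b| <= B) -> `|l - b| <= B.
Proof.
move=> ul uB; apply/ler_addgt0Pr => e e0.
move: ul; rewrite -(cvg_shiftn N) => /cvgrPdist_lt /(_ _ e0).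
case=> n _ /(_ n (leqnn n)) /= lu.
rewrite -(subrK (u (n + N)%N) l) -addrA addrC.
by rewrite (le_trans (ler_normD _ _)) // lerD // ltW.
Qed.

Section CExp.
Variable R : realType.
Implicit Types (x y : R).
Local Notation C := R[i].
Local Notation Ct := (Num.NumField.sort (Num.NumField.clone R[i] _)).

(** The function [e^(ix)] of a real [x]. *)
Definition cexp x : C := (cos x)%:C + 'i * (sin x)%:C.

Lemma cexp0 : cexp 0 = 1.
Proof. by rewrite /cexp cos0 sin0 mulr0 addr0. Qed.

Lemma cexpD x y : cexp (x + y) = cexp x * cexp y.
Proof.
rewrite /cexp cosD sinD rmorphB rmorphD !rmorphM /=.
have i2 := sqrCi C.
ring: i2.
Qed.

Lemma cexp_sum (I : Type) (r : seq I) (F : I -> R) :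
  cexp (\sum_(i <- r) F i) = \prod_(i <- r) cexp (F i).
Proof. exact: (big_morph cexp cexpD cexp0). Qed.

Lemma cexpMn x m : cexp (x *+ m) = cexp x ^+ m.
Proof. by elim: m => [|m IHm]; rewrite ?cexp0 // mulrS cexpD IHm exprS. Qed.

Lemma real_complexR x : x%:C \is @Num.real C.
Proof. by apply/complex_realP; exists x. Qed.

Lemma norm_real_complex x : `|x%:C : C| = `|x|%:C.
Proof. by rewrite normc_def /= expr0n addr0 sqrtr_sqr. Qed.

Lemma norm_cexp x : `|cexp x| = 1.
Proof.
apply/eqP; rewrite -(@pexpr_eq1 _ _ 2) //.
by rewrite normC2_rect ?real_complexR // -!rmorphXn -rmorphD /= cos2Dsin2.
Qed.

Lemma cvg_real_complex (u : R^nat) (l : R) :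
  u @ \oo --> l -> (fun n => (u n)%:C : Ct) @ \oo --> (l%:C : Ct).
Proof.
move=> /cvgrPdist_lt ul; apply/cvgrPdist_lt => e e0.
have eE : e = (complex.Re e)%:C by rewrite RRe_real // gtr0_real.
have e0' : 0 < complex.Re e by move: e0; rewrite eE ltcR.
near=> n; rewrite -rmorphB /= norm_real_complex eE ltcR; near: n; exact: ul.
Unshelve. all: by end_near. Qed.

Lemma exp_series_imaginaryE x k :
  ('i * x%:C) ^+ k / k`!%:R = (cos_coeff x k)%:C + 'i * (sin_coeff x k)%:C :> C.
Proof.
have i_pow : 'i ^+ k = (if odd k then 'i else 1) * (-1) ^+ k./2 :> C.
  rewrite -{1}[k]odd_double_half exprD -mul2n exprM sqrCi.
  by case: (odd k); rewrite ?expr1 ?expr0.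
(* For odd [k] the sine coefficients use the exponent [k.-1./2]. *)
have half_pred : odd k -> k.-1./2 = k./2.
  by case: k {i_pow} => //= k; rewrite uphalf_half => /negbTE ->.
rewrite exprMn i_pow /cos_coeff /sin_coeff /=.
rewrite !rmorphM /= !fmorphV /= !rmorph_nat !rmorphXn /= !rmorphN1.
case: (boolP (odd k)) => [/half_pred->|_];
  rewrite /= ?mul0r ?mul1r ?add0r ?mulr0 ?addr0 //.
by rewrite !mulrA.
Qed.

Lemma cvg_exp_series_imaginary x :
  (fun n => \sum_(k < n) ('i * x%:C) ^+ k / k`!%:R : Ct) @ \oo --> (cexp x : Ct).
Proof.
have cvg_cos : series (cos_coeff x) @ \oo --> cos x.
  by rewrite unlock; exact: is_cvg_series_cos_coeff.
have cvg_sin : series (sin_coeff x) @ \oo --> sin x.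
  by rewrite unlock; exact: is_cvg_series_sin_coeff.
rewrite (_ : (fun n => _) = (fun n => (series (cos_coeff x) n)%:C
    + 'i * (series (sin_coeff x) n)%:C)).
  apply: (@cvgD Ct Ct); first exact: cvg_real_complex.
  by apply: (@cvgM Ct); [exact: cvg_cst|exact: cvg_real_complex].
apply/funext => n; rewrite /series /= !big_mkord !rmorph_sum mulr_sumr -big_split.
by apply: eq_bigr => k _; rewrite exp_series_imaginaryE.
Qed.

(** The first two terms [1 + x i / 2] have modulus at least 1, and the others add up
    to at most the sum of [2^-j] for [2 <= j <= p], which is [1/2 - 2^-p].  The
    term [2^-p] matters when [p = 1], where the final estimate has no slack. *)
Lemma pade_poly_imaginary_ge p x : (0 < p)%N -> `|x| <= 1 ->
  2^-1 + 2 ^- p <= `|pade_poly p ('i * x%:C : C)|.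
Proof.
case: p => [//|p] _ x1.
have zx : `|'i * x%:C : C| <= 1.
  by rewrite normrM normCi mul1r norm_real_complex lecR.
rewrite /pade_poly !big_ord_recl /=.
set s := \sum_(i < p) _.
have sle : `|s| <= 2^-1 - 2 ^- p.+1.
  apply: le_trans (ler_norm_sum _ _ _) _.
  apply: (@le_trans _ _ (\sum_(i < p) (2 ^- i.+2 : C))).
    apply: ler_sum => i _; rewrite normrM normrX ger0_norm ?pade_coef_ge0 //.
    rewrite -[leRHS]mulr1 ler_pM ?pade_coef_ge0 ?exprn_ge0 ?exprn_ile1 //.
    by apply: pade_coef_le; rewrite /bump /= !add1n !ltnS.
  elim: (p) => [|q IHq]; first by rewrite big_ord0 expr1 subrr.
  rewrite big_ord_recr /= (le_trans (lerD IHq (lexx _))) //.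
  rewrite -!exprVn !exprS; set t := _ ^+ q.
  rewrite le_eqVlt; apply/orP; left; apply/eqP.
  by field.
have -> : pade_coef C p.+1 0 = 1.
  rewrite pade_coefE // bin0 subn0 mul1r divff // fact_neq0 //.
set r := pade_coef C p.+1 _.
have rR : r \is Num.real by rewrite ger0_real // pade_coef_ge0.
rewrite expr0 mulr1 expr1 addrA mulrCA.
have le1 : 1 <= `|1 + 'i * (r * x%:C) : C|.
  have yR : r * x%:C \is Num.real by rewrite realM ?real_complexR.
  rewrite -(@ler_pXn2r _ 2) ?nnegrE // normC2_rect ?rpred1 //.
  by rewrite lerDl real_exprn_even_ge0.
apply: le_trans (lerB_normD _ _); rewrite lerBrDr; apply: le_trans le1.
rewrite -lerBrDl (le_trans sle) // le_eqVlt; apply/orP; left; apply/eqP.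
by field; rewrite expf_neq0.
Qed.

Lemma pade_poly_conj p x :
  (pade_poly p ('i * x%:C : C))^*%R = pade_poly p (- ('i * x%:C)).
Proof.
rewrite /pade_poly rmorph_sum; apply: eq_bigr => j _.
rewrite rmorphM rmorphXn rmorphM /= conjCi mulNr conj_Creal; last first.
  by rewrite ger0_real // pade_coef_ge0.
by rewrite conj_Creal // real_complexR.
Qed.

Definition cpade p z : C := pade_poly p z / pade_poly p (- z).

Lemma pade_poly_imaginary_neq0 p x : (0 < p)%N -> `|x| <= 1 ->
  pade_poly p ('i * x%:C : C) != 0.
Proof.
move=> p0 x1; rewrite -normr_gt0 (lt_le_trans _ (pade_poly_imaginary_ge p0 x1)) //.
Qed.

(** On the imaginary axis the denominator is the conjugate of the numerator. *)
Lemma norm_cpade p x : (0 < p)%N -> `|x| <= 1 -> `|cpade p ('i * x%:C)| = 1.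
Proof.
move=> p0 x1; rewrite /cpade -pade_poly_conj normf_div norm_conjC divff //.
by rewrite normr_eq0 pade_poly_imaginary_neq0.
Qed.

Lemma cvg_pade_defect p x :
  (fun n => \sum_(k < n + p) taylor_defect Ct p k * ('i * x%:C) ^+ k) @ \oo -->
  (pade_poly p (- ('i * x%:C)) * cexp x : Ct).
Proof.
rewrite /pade_poly mulr_suml.
under eq_fun => n do rewrite -pade_defectE.
apply: (@cvg_sum Ct) => j.
apply: (@cvgM Ct); first exact: cvg_cst.
have := @cvg_shiftn (p - j) Ct
  (fun n => \sum_(k < n) ('i * x%:C) ^+ k / k`!%:R) (nbhs (cexp x : Ct)).
rewrite /= => ->; exact: cvg_exp_series_imaginary.
Qed.

(** After multiplication by the denominator this is the remainder of the power
    series; the constant [2 p!^2 / (2p)!] is at most [2 * 2^-p], hence at most the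
    lower bound on the denominator. *)
Lemma cpade_error p x : (0 < p)%N -> `|x| <= 1 ->
  `|cexp x - cpade p ('i * x%:C)| <= (`|x| ^+ (2 * p + 1) / (2 * p + 1)`!%:R)%:C.
Proof.
move=> p0 x1; set z : C := 'i * x%:C.
have zx : `|z| = `|x|%:C by rewrite normrM normCi mul1r norm_real_complex.
have Nxz : - z = 'i * (- x)%:C by rewrite rmorphN mulrN.
have x1' : `|- x| <= 1 by rewrite normrN.
have D0 : pade_poly p (- z) != 0 by rewrite Nxz pade_poly_imaginary_neq0.
have -> : cexp x - cpade p z =
    (pade_poly p (- z) * cexp x - pade_poly p z) / pade_poly p (- z).
  by rewrite mulrBl mulrAC divff // mul1r.
rewrite normf_div ler_pdivrMr ?normr_gt0 //.
apply: (@le_trans _ _ (2 * p`!%:R ^+ 2 / (2 * p)`!%:R / (2 * p + 1)`!%:R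
     * `|z| ^+ (2 * p + 1))).
  apply: (@norm_limit_le Ct _ _ _ _ p.+1 (@cvg_pade_defect p x)) => n /=.
  rewrite -addnA (_ : p.+1 + p = 2 * p + 1)%N; last by lia.
  by apply: pade_defect_bound; rewrite zx lecR.
rewrite rmorphM rmorphXn fmorphV rmorph_nat /= -zx.
rewrite [leLHS](_ : _ = `|z| ^+ (2 * p + 1) / (2 * p + 1)`!%:R
  * (2 * (p`!%:R ^+ 2 / (2 * p)`!%:R))); last by ring.
rewrite ler_wpM2l ?mulr_ge0 ?invr_ge0 ?exprn_ge0 //.
rewrite Nxz (le_trans _ (pade_poly_imaginary_ge p0 x1')) //.
have half_ge : 2 ^- p <= 2^-1 :> C.
  by rewrite lef_pV2 ?posrE ?exprn_gt0 // -{1}[2]expr1 ler_eXn2l ?ltr1n.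
have le2p : p`!%:R ^+ 2 / (2 * p)`!%:R <= 2 ^- p :> C.
  by rewrite -[leRHS]mulr1 ler_pdivlMl ?exprn_gt0 // mulrA fact_sqr_le.
by rewrite mulr_natl mulr2n lerD // (le_trans le2p).
Qed.

End CExp.

(** * Functional calculus in a fixed eigenbasis *)

Section DiagBy.
Variables (K : fieldType) (n : nat) (T : 'M[K]_n).
Implicit Types (A B : 'M[K]_n) (d e : 'I_n -> K).

(** [T] conjugates [A] to a diagonal matrix.  In this intertwining form the relation
    is visibly stable under linear combinations and products of [A]. *)
Definition diagby d A := T *m A = diag_mx (\row_k d k) *m T.

Lemma diagbyP d A : diagby d A <-> forall i j, (T *m A) i j = d i * T i j.
Proof.
rewrite /diagby; split=> [-> i j|TA]; first by rewrite mul_diag_mx !mxE.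
by apply/matrixP => i j; rewrite TA mul_diag_mx !mxE.
Qed.

Lemma eq_diagby d e A : d =1 e -> diagby d A -> diagby e A.
Proof. by move=> de /diagbyP TA; apply/diagbyP => i j; rewrite TA de. Qed.

Lemma diagby1 : diagby (fun=> 1) 1%:M.
Proof. by apply/diagbyP => i j; rewrite mulmx1 mul1r. Qed.

Lemma diagbyZ a d A : diagby d A -> diagby (fun k => a * d k) (a *: A).
Proof.
by move=> /diagbyP TA; apply/diagbyP => i j; rewrite -scalemxAr mxE TA mulrA.
Qed.

Lemma diagbyN d A : diagby d A -> diagby (fun k => - d k) (- A).
Proof.
by move=> /diagbyP TA; apply/diagbyP => i j; rewrite mulmxN mxE TA mulNr.
Qed.

Lemma diagbyB d e A B : diagby d A -> diagby e B ->
  diagby (fun k => d k - e k) (A - B).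
Proof.
move=> /diagbyP TA /diagbyP TB; apply/diagbyP => i j.
by rewrite mulmxBr mxE [X in _ + X]mxE TA TB mulrBl.
Qed.

Lemma diagby_sum (I : Type) (r : seq I) (d : I -> 'I_n -> K) (A : I -> 'M[K]_n) :
  (forall i, diagby (d i) (A i)) ->
  diagby (fun k => \sum_(i <- r) d i k) (\sum_(i <- r) A i).
Proof.
move=> dA; apply/diagbyP => i j; rewrite mulmx_sumr summxE mulr_suml.
by apply: eq_bigr => k _; have /diagbyP -> := dA k.
Qed.

Lemma diagbyM d e A B : diagby d A -> diagby e B ->
  diagby (fun k => d k * e k) (A *m B).
Proof.
rewrite /diagby => TA TB; rewrite mulmxA TA -mulmxA TB mulmxA mulmx_diag.
by congr (diag_mx _ *m _); apply/rowP => k; rewrite !mxE.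
Qed.

Lemma diagbyX d A m : diagby d A -> diagby (fun k => d k ^+ m) (A ^+ m).
Proof.
move=> dA; elim: m => [|m IHm]; first exact: diagby1.
rewrite exprS; apply: (eq_diagby (fun k => esym (exprS (d k) m))).
exact: (diagbyM dA IHm).
Qed.

Hypothesis T_unit : T \in unitmx.

Lemma diagbyE d A : diagby d A <-> A = invmx T *m diag_mx (\row_k d k) *m T.
Proof.
rewrite /diagby -mulmxA; split=> [<-|->]; first by rewrite mulKmx.
by rewrite mulKVmx.
Qed.

Lemma diagbyV d A : (forall k, d k != 0) -> diagby d A ->
  diagby (fun k => (d k)^-1) (invmx A).
Proof.
move=> d0 dA.
pose B := invmx T *m diag_mx (\row_k (d k)^-1) *m T.
have dB : diagby (fun k => (d k)^-1) B by apply/diagbyE.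
have BA : B *m A = 1%:M.
  have /diagbyE -> := diagbyM dB dA; have /diagbyE -> := diagby1.
  by congr (_ *m diag_mx _ *m _); apply/rowP => k; rewrite !mxE mulVf.
suff -> : invmx A = B by [].
by rewrite -[invmx A]mul1mx -BA mulmxK //; case: (mulmx1_unit BA).
Qed.

End DiagBy.

Lemma diagby_pade (K : numFieldType) n (T A : 'M[K]_n) (d : 'I_n -> K) p :
  T \in unitmx -> (forall k, pade_poly p (- d k) != 0) -> diagby T d A ->
  diagby T (fun k => pade_poly p (d k) / pade_poly p (- d k)) (pade p A).
Proof.
move=> T_unit den_neq0 dA.
have num (B : 'M[K]_n) e :
    diagby T e B -> diagby T (fun k => pade_poly p (e k)) (pade_num p B).
  by move=> eB; apply: diagby_sum => j; apply/diagbyZ/diagbyX.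
apply: (eq_diagby (fun k => mulrC _ _)); apply: diagbyM; last exact: num.
by apply: diagbyV => //; apply: num; exact: diagbyN.
Qed.

Lemma cvg_mx (K : numFieldType) (n : nat) (u : nat -> 'M[K]_n) (l : 'M[K]_n) :
  (forall i j, (fun k => u k i j) @ \oo --> l i j) -> u @ \oo --> l.
Proof.
move=> ul; apply/cvg_ballP => e e0.
have : \forall k \near \oo,
    forall ij : 'I_n * 'I_n, ball (l ij.1 ij.2) e (u k ij.1 ij.2).
  by apply: filter_forall => -[i j] /=; exact: (cvg_ball (ul i j)).
by apply: filterS => k lu; split=> // i j; exact: (lu (i, j)).
Qed.

Lemma diagby_expmx (K : numFieldType) n (T A : 'M[K]_n) (d e : 'I_n -> K) :
  T \in unitmx -> diagby T d A ->
  (forall j, (fun N => \sum_(k < N) d j ^+ k / k`!%:R) @ \oo --> e j) ->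
  diagby T e (expmx A).
Proof.
move=> T_unit dA de; apply/diagbyE => //.
apply: cvg_lim; first exact: norm_hausdorff.
apply: cvg_mx => i j; rewrite mxE.
have partialE N : series (fun k => k`!%:R^-1 *: A ^+ k) N =
   invmx T *m diag_mx (\row_i \sum_(k < N) d i ^+ k / k`!%:R) *m T.
  apply/diagbyE => //; rewrite /series /= big_mkord.
  apply: diagby_sum => k; apply: (eq_diagby (fun i => mulrC _ _)).
  exact/diagbyZ/diagbyX.
under eq_fun => N do rewrite partialE mxE.
apply: cvg_sum => k.
under eq_fun => N do rewrite mul_mx_diag !mxE.
rewrite mul_mx_diag !mxE.
by apply: cvgM; [apply: cvgM; [exact: cvg_cst|exact: de]|exact: cvg_cst].
Qed.

(** * Entries of iterated Kronecker products *)

Lemma bigtens_mul (K : comPzRingType) M (N : 'I_M -> nat)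
    (A B : forall a, 'M[K]_(N a)) :
  bigtens (fun a => A a *m B a) = bigtens A *m bigtens B.
Proof.
elim: M N A B => [|M IHM] N A B /=; first by rewrite mulmx1.
by rewrite mxtens.tensmx_mul -IHM.
Qed.

Lemma bigtens_adjoint (C : numClosedFieldType) M (N : 'I_M -> nat)
    (A : forall a, 'M[C]_(N a)) :
  bigtens (fun a => (A a) ^t*) = (bigtens A) ^t*.
Proof.
elim: M N A => [|M IHM] N A /=; first by rewrite trmx1 map_mx1.
by rewrite mxtens.trmx_tens mxtens.map_mxT -IHM.
Qed.

Lemma dependent_selection (I : Type) (F : I -> Type) (P : forall a, F a -> Prop) :
  (forall a, exists v, P a v) -> exists f : forall a, F a, forall a, P a (f a).
Proof. by move=> exP; exists (fun a => projT1 (cid (exP a))) => a; case: cid. Qed.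

(** Multi-indices are dependent functions, so they are extended by one component
    through existence, with casts along equalities in ['I_M.+1], whose proofs are
    unique. *)
Lemma ord_cons_dep M (F : 'I_M.+1 -> Type) (x : F ord0)
    (y : forall a, F (lift ord0 a)) :
  exists z : forall a, F a, z ord0 = x /\ forall a, z (lift ord0 a) = y a.
Proof.
suff /dependent_selection [z zP] : forall a, exists v : F a,
   (forall e : ord0 = a, v = eq_rect _ F x _ e) /\
   (forall b (e : lift ord0 b = a), v = eq_rect _ F (y b) _ e).
  exists z; split; first by have [/(_ erefl)] := zP ord0.
  by move=> a; have [_ /(_ a erefl)] := zP (lift ord0 a).
move=> a; case: (unliftP ord0 a) => [b ->|->].
  exists (y b); split=> [e|c e]; first by have := congr1 val e.
  have ebc := lift_inj e; case: _ / ebc in e *.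
  by rewrite (eq_irrelevance e erefl).
exists x; split=> [e|b e]; first by rewrite (eq_irrelevance e erefl).
by have := congr1 val e.
Qed.

(** [idx] reads the digits of a row number in the mixed radix system given by the
    dimensions.  It does not depend on the matrices, which is what allows
    different operators to be compared at the same multi-index. *)
Lemma bigtens_diag (K : pzRingType) M (N : 'I_M -> nat) :
  exists idx : 'I_(tensdim N) -> forall a, 'I_(N a),
  forall d : forall a, 'I_(N a) -> K,
    bigtens (fun a => diag_mx (\row_k d a k)) =
    diag_mx (\row_k \prod_a d a (idx k a)).
Proof.
elim: M N => [|M IHM] N.
  have empty (a : 'I_0) : 'I_(N a) by case: a.
  exists (fun _ => empty) => d /=.
  by apply/matrixP => i j; rewrite (ord1 i) (ord1 j) !mxE big_ord0.
have [idx' idxP] := IHM (fun a => N (lift ord0 a)).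
have /dependent_selection [idx idxE] k := @ord_cons_dep M (fun a => 'I_(N a))
  (mxtens.mxtens_unindex k).1 (idx' (mxtens.mxtens_unindex k).2).
exists idx => d /=; rewrite idxP.
apply/matrixP => i j; rewrite !mxE big_ord_recl.
have [-> idx_lift] := idxE i.
under [in RHS]eq_bigr => a _ do rewrite idx_lift.
have -> : (i == j) = ((mxtens.mxtens_unindex i).1 == (mxtens.mxtens_unindex j).1)
    && ((mxtens.mxtens_unindex i).2 == (mxtens.mxtens_unindex j).2).
  rewrite -(inj_eq (can_inj (@mxtens.mxtens_unindexK _ _)) i j).
  by rewrite -xpair_eqE -!surjective_pairing.
by case: eqP => [->|_]; case: eqP => [->|_]; rewrite ?mulr0n ?mulr1n ?mul0r ?mulr0.
Qed.

Lemma eq_bigtens (K : pzRingType) M (N : 'I_M -> nat) (A B : forall a, 'M[K]_(N a)) :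
  (forall a, A a = B a) -> bigtens A = bigtens B.
Proof. by move=> AB; congr bigtens; apply: functional_extensionality_dep. Qed.

Lemma bigtens1 (K : pzRingType) M (N : 'I_M -> nat) :
  bigtens (fun a => 1%:M : 'M[K]_(N a)) = 1%:M.
Proof.
have diag1 n : 1%:M = diag_mx (\row_(k < n) (1 : K)).
  by apply/matrixP => i j; rewrite !mxE.
have [idx idxP] := @bigtens_diag K M N.
rewrite (eq_bigtens (fun a => diag1 (N a))) (idxP (fun _ _ => 1)) [RHS]diag1.
by congr diag_mx; apply/rowP => k; rewrite !mxE big1.
Qed.

Lemma bigtens_unit (K : comUnitRingType) M (N : 'I_M -> nat)
    (T : forall a, 'M[K]_(N a)) :
  (forall a, T a \in unitmx) -> bigtens T \in unitmx.
Proof.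
move=> T_unit; pose V a := invmx (T a).
apply: (proj1 (@mulmx1_unit _ _ (bigtens T) (bigtens V) _)).
by rewrite -bigtens_mul -[RHS]bigtens1; apply: eq_bigtens => a; exact: mulmxV.
Qed.

Lemma diagby_bigtens (K : fieldType) M (N : 'I_M -> nat) :
  exists idx : 'I_(tensdim N) -> forall a, 'I_(N a),
  forall (T A : forall a, 'M[K]_(N a)) (d : forall a, 'I_(N a) -> K),
  (forall a, diagby (T a) (d a) (A a)) ->
  diagby (bigtens T) (fun k => \prod_a d a (idx k a)) (bigtens A).
Proof.
have [idx idxP] := @bigtens_diag K M N.
exists idx => T A d dA; rewrite /diagby -idxP -!bigtens_mul.
exact: eq_bigtens.
Qed.

(** * Operator norm for a Gram matrix *)

Section OpNorm.
Variables (R : realType) (n : nat).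
Implicit Types (G A T : 'M[R[i]]_n) (d : 'I_n -> R[i]).

Lemma inner_gram G T u : G = T ^t* *m T ->
  inner G u u = \sum_k `|(T *m u) k ord0| ^+ 2.
Proof.
move=> ->; rewrite /inner mulmxA -map_mxM -trmx_mul -mulmxA mxE.
by apply: eq_bigr => k _; rewrite !mxE normCK mulrC.
Qed.

Lemma vnorm_gram G T u : G = T ^t* *m T ->
  (vnorm G u ^+ 2)%:C = \sum_k `|(T *m u) k ord0| ^+ 2.
Proof.
move=> GE; have := inner_gram u GE; set s := \sum_k _ => innerE.
have s_ge0 : 0 <= s by apply: sumr_ge0 => k _; rewrite exprn_ge0.
rewrite /vnorm innerE sqr_sqrtr ?RRe_real ?ger0_real //.
by rewrite -ler0c RRe_real ?ger0_real.
Qed.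

Lemma vnorm_diagby_le G T A d u (B : R) : G = T ^t* *m T -> diagby T d A ->
  0 <= B -> (forall k, `|d k| <= B%:C) -> vnorm G (A *m u) <= B * vnorm G u.
Proof.
move=> GE dA B0 dB.
rewrite -(@ler_pXn2r _ 2) ?nnegrE ?mulr_ge0 ?sqrtr_ge0 //.
rewrite -lecR exprMn [leRHS]rmorphM /= !(vnorm_gram _ GE) mulr_sumr.
apply: ler_sum => k _; rewrite mulmxA dA -mulmxA mul_diag_mx !mxE.
rewrite normrM exprMn ler_wpM2r ?exprn_ge0 // rmorphXn /=.
by rewrite lerXn2r ?dB ?nnegrE ?normr_ge0 // ler0c.
Qed.

Lemma opnorm_diagby_le G T A d (B : R) : G = T ^t* *m T -> diagby T d A ->
  0 <= B -> (forall k, `|d k| <= B%:C) -> opnorm G A <= B.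
Proof.
move=> GE dA B0 dB; rewrite /opnorm; set E := [set _ | _ in _].
have [->|/set0P E0] := eqVneq E set0; first by rewrite sup0.
apply: ge_sup => // _ [u /= u1 <-].
by rewrite -[leRHS]mulr1 -u1; exact: vnorm_diagby_le dA _ _.
Qed.

(** The [k]-th column of the inverse of [T] is a unit eigenvector; the sum of the
    moduli of the eigenvalues shows that the supremum is finite. *)
Lemma eigenvalue_le_opnorm G T A d k : T \in unitmx -> G = T ^t* *m T ->
  diagby T d A -> `|d k| <= (opnorm G A)%:C.
Proof.
move=> T_unit GE dA.
pose B := complex.Re (\sum_j `|d j|).
have BE : B%:C = \sum_j `|d j|.
  by rewrite RRe_real // ger0_real // sumr_ge0.
have B0 : 0 <= B by rewrite -ler0c BE sumr_ge0.
have dB j : `|d j| <= B%:C by rewrite BE (bigD1 j) //= lerDl sumr_ge0.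
pose v := invmx T *m delta_mx k ord0 : 'cV_n.
have Tv : T *m v = delta_mx k ord0 by rewrite mulKVmx.
have norm_col : forall (c : R[i]) u, T *m u = c *: delta_mx k ord0 ->
    (vnorm G u)%:C = `|c|.
  move=> c u Tu; apply/eqP; rewrite -(@eqrXn2 _ 2) ?normr_ge0 ?ler0c ?sqrtr_ge0 //.
  rewrite -rmorphXn /= (vnorm_gram _ GE) Tu (bigD1 k) //= big1 => [|j jk].
    by rewrite !mxE !eqxx mulr1 addr0.
  by rewrite !mxE (negbTE jk) mulr0 normr0 expr0n.
rewrite -(norm_col (d k) (A *m v)); last first.
  rewrite mulmxA dA -mulmxA Tv; apply/colP => i; rewrite mul_diag_mx !mxE.
  by case: eqP => [->|]; rewrite ?mulr0.
rewrite lecR; apply: ub_le_sup; last first.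
  exists v => //=; apply: (@complexI R); rewrite (norm_col 1) ?normr1 //.
  by rewrite scale1r.
exists B => _ [u /= u1 <-].
by rewrite -[leRHS]mulr1 -u1; exact: vnorm_diagby_le dA _ _.
Qed.

End OpNorm.

(** * Diagonalization of self-adjoint matrices *)

Lemma trmxC_mul (C : numClosedFieldType) m n p (A : 'M[C]_(m, n))
    (B : 'M[C]_(n, p)) :
  (A *m B) ^t* = B ^t* *m A ^t*.
Proof. by rewrite trmx_mul map_mxM. Qed.

Lemma hermsymmx_spectral (C : numClosedFieldType) n (A : 'M[C]_n) :
  A \is hermsymmx -> exists (P : 'M[C]_n) (d : 'I_n -> C),
  [/\ P \in unitmx, P ^t* *m P = 1%:M, diagby P d A & forall k, d k \is Num.real].
Proof.
move=> A_herm; pose P := spectralmx A.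
have P_unit : P \in unitmx := spectral_unit A.
have PP : P ^t* *m P = 1%:M.
  by rewrite -invmx_unitary ?spectral_unitarymx // mulVmx.
exists P, (fun k => spectral_diag A 0 k); split=> // [|k].
  apply/diagbyE => //.
  have /orthomx_spectralP {1}-> := hermitian_normalmx A_herm.
  by congr (_ *m diag_mx _ *m _); apply/rowP => k; rewrite mxE.
by have /mxOverP := hermitian_spectral_diag_real A_herm; apply.
Qed.

(** In a unitary eigenbasis [P] of [G] the eigenvalues are positive, being values of
    the quadratic form, so [diag (sqrt g) P] is a factor. *)
Lemma hermposdef_gram (R : realType) n (G : 'M[R[i]]_n) :
  hermposdefmx G -> exists2 S, S \in unitmx & G = S ^t* *m S.
Proof.
move=> [G_herm G_pos].
have [P [g [P_unit PP gG _]]] := hermsymmx_spectral G_herm.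
have Padj : invmx P = P ^t* by rewrite -[RHS](mulmxK P_unit) PP mul1mx.
have GE : G = P ^t* *m diag_mx (\row_k g k) *m P by rewrite -Padj; apply/diagbyE.
have g_gt0 k : 0 < g k.
  pose u := P ^t* *m delta_mx k ord0 : 'cV_n.
  have Pu : P *m u = delta_mx k ord0 by rewrite mulmxA -Padj mulmxV // mul1mx.
  have u0 : u != 0.
    apply/eqP => uE; move: Pu; rewrite uE mulmx0 => /colP/(_ k)/eqP.
    by rewrite !mxE !eqxx eq_sym oner_eq0.
  have := G_pos u u0; rewrite /inner GE !mulmxA -trmxC_mul -!mulmxA Pu mulmxA.
  rewrite mul_mx_diag mxE (bigD1 k) //= big1 => [|j jk].
    by rewrite !mxE !eqxx addr0 conjC1 mulr1 mul1r.
  by rewrite !mxE (negbTE jk) mulr0.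
exists (diag_mx (\row_k sqrtC (g k)) *m P).
  rewrite unitmx_mul P_unit andbT unitmxE det_diag unitfE.
  by apply/prodf_neq0 => k _; rewrite mxE sqrtC_eq0 gt_eqF.
rewrite trmxC_mul {1}GE -!mulmxA; congr (_ *m _); rewrite !mulmxA; congr (_ *m _).
apply/matrixP => i j; rewrite mul_mx_diag !mxE.
case: eqVneq => [->|ij]; last by rewrite mulr0n conjC0 mul0r.
rewrite !mulr1n conj_Creal -?expr2 ?sqrtCK //.
by rewrite ger0_real // sqrtC_ge0 ltW.
Qed.

(** With [G = S^* S], self-adjointness of [H] says that [S H S^-1] is Hermitian; a
    unitary [Q] diagonalizing it leaves the Gram matrix of [Q S] equal to [G]. *)
Lemma selfadjoint_diagonalizable (R : realType) n (G H : 'M[R[i]]_n) :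
  hermposdefmx G -> selfadjoint G H ->
  exists T (lam : 'I_n -> R), [/\ T \in unitmx, G = T ^t* *m T &
    diagby T (fun k => (lam k)%:C) H].
Proof.
move=> G_pos H_sa; have [S S_unit GE] := hermposdef_gram G_pos.
have S_adj_unit : S ^t* \in unitmx by rewrite map_unitmx unitmx_tr.
have HG : H ^t* *m G = G *m H.
  by rewrite -{2}H_sa /adjmx !mulmxA mulmxV ?mul1mx // GE unitmx_mul S_adj_unit.
pose B := S *m H *m invmx S.
have BS : B *m S = S *m H by rewrite mulmxKV.
have B_herm : B \is hermsymmx.
  apply/is_hermitianmxP; rewrite expr0 scale1r.
  apply: (can_inj (mulmxK S_unit)); rewrite BS.
  apply: (can_inj (mulKmx S_adj_unit)).
  by rewrite !mulmxA -trmxC_mul BS -GE -HG trmxC_mul -mulmxA -GE.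
have [Q [l [Q_unit QQ lB l_real]]] := hermsymmx_spectral B_herm.
exists (Q *m S), (fun k => complex.Re (l k)); split.
- by rewrite unitmx_mul Q_unit.
- by rewrite trmxC_mul mulmxA -[X in X *m S]mulmxA QQ mulmx1.
rewrite /diagby -mulmxA -BS mulmxA lB -!mulmxA; congr (diag_mx _ *m _).
by apply/rowP => k; rewrite !mxE RRe_real.
Qed.

(** * Global error *)

(** Replacing the factors one at a time costs [|a i - b i|] each, the remaining
    factors having modulus at most 1. *)
Lemma norm_prod_sub_le (K : numDomainType) (I : Type) (r : seq I) (a b : I -> K) :
  (forall i, `|a i| <= 1) -> (forall i, `|b i| <= 1) ->
  `|\prod_(i <- r) a i - \prod_(i <- r) b i| <= \sum_(i <- r) `|a i - b i|.
Proof.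
move=> a1 b1; elim: r => [|i r IHr]; first by rewrite !big_nil subrr normr0.
rewrite !big_cons; set A := \prod_(j <- r) a j; set B := \prod_(j <- r) b j.
have B1 : `|B| <= 1 by rewrite normr_prod prodr_ile1 // => j; rewrite normr_ge0 b1.
rewrite (_ : _ - _ = (a i - b i) * B + a i * (A - B)); last by ring.
rewrite (le_trans (ler_normD _ _)) // !normrM lerD //.
  by rewrite ler_piMr.
by apply: le_trans IHr; rewrite ler_piMl.
Qed.

Lemma norm_exp_sub_le (K : numDomainType) (a b : K) m :
  `|a| <= 1 -> `|b| <= 1 -> `|a ^+ m - b ^+ m| <= m%:R * `|a - b|.
Proof.
move=> a1 b1; have := @norm_prod_sub_le K _ (index_enum 'I_m) (fun=> a) (fun=> b).
rewrite !prodr_const sumr_const card_ord mulr_natl; exact.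
Qed.

Theorem theorem3p1 (R : realType) (M p : nat) (M_ge1 : (1 <= M)%N)
    (p_ge1 : (1 <= p)%N) (N : 'I_M -> nat)
    (G H : forall a : 'I_M, 'M[R[i]]_(N a))
    (G_posdef : forall a, hermposdefmx (G a))
    (H_neq0 : forall a, H a != 0)
    (H_selfadjoint : forall a, selfadjoint (G a) (H a))
    (tau : R) (tau_gt0 : 0 < tau) (tau_lt1 : tau < 1)
    (tauH_lt1 : forall a, tau * opnorm (G a) (H a) < 1) :
  let H0 := tenssum H in
  let U := bigtens (fun a => pade p (- ('i * tau%:C) *: H a)) in
  exists h : R, 0 < h < 1 /\
    forall m : nat, (0 < m)%N ->
      opnorm (bigtens G) (expmx (- ('i * m%:R * tau%:C) *: H0) - U ^+ m)
        <= (2 ^+ M - 1) * m%:R ^+ (2 * p + 1) / ((2 * p + 1)`!)%:R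
           * h ^+ (2 * p + 1).
Proof.
move=> H0 U.
have /dependent_selection [T /dependent_selection [lam TlamP]] a :=
  selfadjoint_diagonalizable (G_posdef a) (H_selfadjoint a).
have T_unit a : T a \in unitmx by have [] := TlamP a.
have GE a : G a = (T a) ^t* *m T a by have [] := TlamP a.
have lamH a : diagby (T a) (fun k => (lam a k)%:C) (H a) by have [] := TlamP a.
pose h := \big[Num.max/2^-1]_(a < M) (tau * opnorm (G a) (H a)).
have h_gt0 : 0 < h by apply: lt_le_trans (bigmax_ge_id _ _ _ _).
have h_lt1 : h < 1 by apply: bigmax_lt => //; rewrite invf_lt1 ?ltr1n.
exists h; split=> [|m m_gt0]; first by rewrite h_gt0.
pose x a k := - (tau * lam a k).
have x_le a k : `|x a k| <= h.
  rewrite normrN normrM gtr0_norm //; apply: le_trans (le_bigmax _ _ a).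
  rewrite ler_wpM2l ?(ltW tau_gt0) // -lecR -norm_real_complex.
  exact: (eigenvalue_le_opnorm k (T_unit a) (GE a) (lamH a)).
have x_le1 a k : `|x a k| <= 1 by rewrite (le_trans (x_le a k)) // ltW.
have padeH a : diagby (T a) (fun k => cpade p ('i * (x a k)%:C))
    (pade p (- ('i * tau%:C) *: H a)).
  have xE k : - ('i * tau%:C) * (lam a k)%:C = 'i * (x a k)%:C.
    by rewrite /x rmorphN rmorphM mulrN mulNr mulrA.
  have den_neq0 k : pade_poly p (- ('i * (x a k)%:C)) != 0.
    by rewrite -mulrN -rmorphN pade_poly_imaginary_neq0 // normrN.
  apply: diagby_pade => //.
  exact: eq_diagby xE (diagbyZ _ (lamH a)).
have [idx idxP] := @diagby_bigtens R[i] M N.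
have bigT_unit : bigtens T \in unitmx by exact: bigtens_unit.
have bigGE : bigtens G = (bigtens T) ^t* *m bigtens T.
  by rewrite -bigtens_adjoint -bigtens_mul; exact: eq_bigtens.
have H0_diag : diagby (bigtens T) (fun k => (\sum_a lam a (idx k a))%:C) H0.
  (* In the [a]-th summand all factors but one are identities, with eigenvalue 1. *)
  pose e a b k : R[i] := if b == a then (lam b k)%:C else 1.
  have eP a : diagby (bigtens T) (fun k => \prod_b e a b (idx k b))
      (bigtens (fun b => if b == a then H b else 1%:M)).
    by apply: idxP => b; rewrite /e; case: eqP => _; [exact: lamH|exact: diagby1].
  apply: eq_diagby (diagby_sum _ eP) => k; rewrite rmorph_sum.
  apply: eq_bigr => a _; rewrite (bigD1 a) //= /e eqxx big1 ?mulr1 // => b.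
  by move=> /negbTE ->.
have U_diag := diagbyX m (idxP _ _ _ padeH).
have E_diag : diagby (bigtens T)
    (fun k => (\prod_a cexp (x a (idx k a))) ^+ m)
    (expmx (- ('i * m%:R * tau%:C) *: H0)).
  apply: (diagby_expmx bigT_unit (diagbyZ _ H0_diag)) => k.
  rewrite -cexp_sum -cexpMn.
  pose y := (\sum_a x a (idx k a)) *+ m; rewrite -/y.
  have -> : - ('i * m%:R * tau%:C) * (\sum_a lam a (idx k a))%:C = 'i * y%:C.
    rewrite /y sumrN -mulr_sumr mulNrn rmorphN rmorphMn rmorphM /= -mulr_natl.
    by ring.
  exact: cvg_exp_series_imaginary.
set bound := (2 ^+ M - 1) * _ / _ * _.
(* This is where [M <= 2 ^+ M - 1] and [m <= m ^+ (2 * p + 1)] enter. *)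
have bound_ge : m%:R * (M%:R * (h ^+ (2 * p + 1) / (2 * p + 1)`!%:R)) <= bound.
  rewrite /bound -!mulrA [_^-1 * _]mulrC mulrCA.
  apply: ler_pM; rewrite ?mulr_ge0 ?invr_ge0 ?exprn_ge0 // ?(ltW h_gt0) //.
    rewrite lerBrDr natr1 -natrX ler_nat; exact: ltn_expl.
  rewrite ler_wpM2r ?mulr_ge0 ?invr_ge0 ?exprn_ge0 // ?(ltW h_gt0) //.
  by rewrite -natrX ler_nat -{1}[m]expn1 leq_pexp2l // addn1.
apply: (opnorm_diagby_le bigGE (diagbyB E_diag U_diag)) => [|k].
  by rewrite (le_trans _ bound_ge) // !mulr_ge0 ?invr_ge0 ?exprn_ge0 ?(ltW h_gt0).
apply: (le_trans (norm_exp_sub_le _ _ _)).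
- by rewrite normr_prod prodr_ile1 // => a _; rewrite norm_cexp ler01 lexx.
- by rewrite normr_prod prodr_ile1 // => a _; rewrite norm_cpade // ler01 lexx.
rewrite -lecR in bound_ge; apply: le_trans bound_ge; set b := h ^+ _ / _.
rewrite 2!rmorphM !rmorph_nat /= ler_wpM2l //.
apply: (le_trans (norm_prod_sub_le _ _ _)) => [a|a|].
- by rewrite norm_cexp.
- by rewrite norm_cpade.
apply: (@le_trans _ _ (\sum_(a < M) b%:C)); last first.
  by rewrite sumr_const card_ord mulr_natl.
apply: ler_sum => a _; apply: (le_trans (cpade_error p_ge1 (x_le1 _ _))).
by rewrite lecR ler_wpM2r ?invr_ge0 // lerXn2r ?nnegrE ?(ltW h_gt0).
Qed.
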